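(* Let $p \ge q \ge d+1$ be positive integers. (i) If $q \ge p-q+(d+1)$ and $\mathcal F$ is a family of closed convex sets in $\mathbb R^d$ that contains at least $p-q+1$ bounded members and satisfies the $(p,q)$-property, then $$\pi(\mathcal F) \le \xi(q-1,d,d-1)\,\xi(p,q,d) + p-q+1.$$ (ii) If $q < p-q+(d+1)$, then there exists a family $\mathcal F$ of closed convex sets in $\mathbb R^d$ that contains infinitely many bounded members, satisfies the $(p,q)$-property, and has $\pi(\mathcal F)=\infty$.
   Context: A family $\mathcal F$ of at least $p$ closed convex sets in $\mathbb R^d$ satisfies the $(p,q)$-property if among any $p$ members of $\mathcal F$ there are $q$ with a common point. The piercing number $\pi(\mathcal F)$ is the minimum cardinality of a set $S\subset\mathbb R^d$ such that every member of $\mathcal F$ contains a point of $S$; if no finite such $S$ exists, $\pi(\mathcal F)=\infty$. For positive integers $p\ge q\ge d+1$, $\xi(p,q,d)$ denotes the smallest integer $c$ such that every finite family of closed convex sets in $\mathbb R^d$ with the $(p,q)$-property satisfies $\pi\le c$ (this is finite by the Alon–Kleitman $(p,q)$-theorem). *)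

(* Defs.v *)
From Stdlib Require Import Reals.
From mathcomp Require Import all_boot.
Set Implicit Arguments. Unset Strict Implicit. Unset Printing Implicit Defensive.

Definition point (d : nat) := 'I_d -> R.
Definition rset (d : nat) := point d -> Prop.

Local Open Scope R_scope.

Definition convex_set d (C : rset d) : Prop :=
  forall x y : point d, C x -> C y -> forall t : R, 0 <= t <= 1 ->
    C (fun i => t * x i + (1 - t) * y i).

(* Closed in the Euclidean topology (equivalently, in the sup-norm one). *)
Definition closed_set d (C : rset d) : Prop :=
  forall x : point d,
    (forall eps : R, 0 < eps -> exists y, C y /\ forall i, Rabs (x i - y i) < eps) ->
    C x.

Definition bounded_set d (C : rset d) : Prop :=
  exists M : R, forall x : point d, C x -> forall i, Rabs (x i) <= M.

Definition closed_convex d (C : rset d) : Prop :=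
  (exists x, C x) /\ convex_set C /\ closed_set C.

Local Close Scope R_scope.

Definition pq_property (p q d : nat) (I : Type) (F : I -> rset d) : Prop :=
  (exists f : 'I_p -> I, injective f) /\
  forall f : 'I_p -> I, injective f ->
    exists g : 'I_q -> 'I_p, injective g /\
      exists x : point d, forall j, F (f (g j)) x.

Definition pierces d (I : Type) (F : I -> rset d) (S : seq (point d)) : Prop :=
  forall i, exists x, List.In x S /\ F i x.

Definition piercing_le d (I : Type) (F : I -> rset d) (k : nat) : Prop :=
  exists S : seq (point d), size S <= k /\ pierces F S.

Definition piercing_infinite d (I : Type) (F : I -> rset d) : Prop :=
  forall S : seq (point d), ~ pierces F S.

Definition xi_bound (p q d c : nat) : Prop :=
  forall (n : nat) (F : 'I_n -> rset d),
    (forall i, closed_convex (F i)) -> pq_property p q F -> piercing_le F c.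

Definition is_xi (p q d c : nat) : Prop :=
  xi_bound p q d c /\ forall c', xi_bound p q d c' -> c <= c'.

(* Main.v *)
From Stdlib Require Import Reals Lra.
From mathcomp Require Import all_boot zify.
From mathcomp Require Import boolp filter.
Require Import Defs.
Set Implicit Arguments. Unset Strict Implicit. Unset Printing Implicit Defensive.

(* The MathComp imports above rebind the key [R] to [ring_scope]. *)
Delimit Scope R_scope with R.

(** (i) Set the p-q+1 bounded members aside; they are pierced by one point each.
  Adding them to any q-1 of the other members shows that d of those q-1 meet inside
  a fixed box. Every finite subfamily is pierced by xi(p,q,d) points of R^d; let these
  points converge along an ultrafilter in the compactification of R^d by directions.
  A finite limit point lies in all the sets it was responsible for. If the limit is a
  direction u, then u is a direction of recession of all these sets; project along u
  the intersections of all the members with the box. These compact convex sets in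
  R^(d-1) have the (q-1,d)-property, hence (by compactness again) are pierced by
  xi(q-1,d,d-1) points, and each of these lifts to one point far enough in direction u.

  (ii) Take infinitely many copies of a large box and the sets
  |1 + sum_(1 <= k < d) z_k m^k| <= z_0 / m for m = 1, 2, ... Finitely many of the
  latter always meet (far away), any d-1 of them meet inside the box, and a given
  point lies in finitely many of them because a polynomial with constant term 1 is
  bounded away from 0 at infinity. Among p members either q unbounded ones occur, or
  at least p-q+1 boxes, which meet together with d-1 unbounded members. *)

(** * Lists of points and injections into finite sets *)

Lemma In_nth (X : Type) (x0 x : X) (s : seq X) :
  List.In x s -> exists2 k, k < size s & nth x0 s k = x.
Proof.
elim: s => //= a s IH [->|/IH[k hk e]]; first by exists 0.
by exists k.+1.
Qed.

Lemma In_map (T : eqType) (X : Type) (h : T -> X) (s : seq T) (j : T) :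
  j \in s -> List.In (h j) [seq h i | i <- s].
Proof.
by elim: s => //= a s IH; rewrite inE => /predU1P[->|/IH]; [left|right].
Qed.

Lemma In_flatten_map (T : eqType) (X : Type) (h : T -> seq X) (s : seq T) j x :
  j \in s -> List.In x (h j) -> List.In x (flatten [seq h i | i <- s]).
Proof.
elim: s => //= a s IH; rewrite inE => /predU1P[->|js] xj;
  apply: List.in_or_app; [by left|by right; apply: IH].
Qed.

Lemma size_flatten_map (T X : Type) (h : T -> seq X) (s : seq T) c :
  (forall j, size (h j) <= c) -> size (flatten [seq h i | i <- s]) <= c * size s.
Proof.
move=> hc; elim: s => //= a s IH; rewrite size_cat.
by have := hc a; nia.
Qed.

Lemma injection_into (T : finType) (D : {set T}) n :
  n <= #|D| -> exists2 g : 'I_n -> T, injective g & forall j, g j \in D.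
Proof.
move=> hn; exists (fun j => enum_val (widen_ord hn j)).
  by move=> a b /enum_val_inj/(congr1 val) /= ab; apply: val_inj.
by move=> j; apply: enum_valP.
Qed.

(** * Compactness *)

Section Compactness.
Local Open Scope R_scope.

Lemma ultra_exists (T : Type) (U : classical_sets.set_system T) (J : finType)
    (P : J -> T -> Prop) :
  UltraFilter U -> U (fun S => exists j, P j S) -> exists j, U (P j).
Proof.
move=> UU UP; apply: contrapT => nU.
have UC : forall j, U (classical_sets.setC (P j)).
  by move=> j; have [Uj|//] := in_ultra_setVsetC (P j) UU; case: nU; exists j.
have [S [[j Pj] nP]] := filter_ex (filterI UP (filter_forall _ UC)).
exact: nP Pj.
Qed.

Lemma ultra_cvg (T : Type) (U : classical_sets.set_system T) (f : T -> R) M :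
  UltraFilter U -> U (fun S => Rabs (f S) <= M) ->
  exists l, forall eps, 0 < eps -> U (fun S => Rabs (f S - l) < eps).
Proof.
move=> UU UM.
(* The limit is the supremum of the levels that [f] reaches on a set of [U]. *)
pose E a := U (fun S => a <= f S).
have Eb : bound E.
  exists M => a Ea; have [S [/= aS SM]] := filter_ex (filterI Ea UM).
  by move: (Rle_abs (f S)); lra.
have En : exists a, E a.
  exists (- M); apply: filterS UM => S /= SM.
  by have := Rle_abs (- f S); rewrite Rabs_Ropp; lra.
have [l [lub least]] := completeness E Eb En.
exists l => eps e0.
have [a Ea la] : exists2 a, E a & l - eps < a.
  apply: contrapT => na.
  suff: l <= l - eps by lra.
  apply: least => a Ea; case: (Rle_lt_dec a (l - eps)) => // ?.
  by case: na; exists a.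
have [E2|E2] := in_ultra_setVsetC (fun S => l + eps / 2 <= f S) UU.
  by have := lub _ E2; lra.
apply: filterS (filterI Ea E2) => S [/= aS /Rnot_le_lt Sl].
by apply: Rabs_def1; lra.
Qed.

(* Every finite subfamily is pierced by a c-tuple; a limit of these tuples along
   an ultrafilter pierces all closures at once. *)
Lemma compact_piercing (I X : Type) (K : finType) (x0 : X) (phi : X -> K -> R)
    (M : R) (c : nat) (A : I -> X -> Prop) :
  (forall i x k, A i x -> Rabs (phi x k) <= M) ->
  (forall n (g : 'I_n -> I), exists S : seq X, (size S <= c)%N /\
     forall m, exists x, List.In x S /\ A (g m) x) ->
  exists L : 'I_c -> K -> R, forall i, exists j, forall eps, 0 < eps ->
    exists x, A i x /\ forall k, Rabs (phi x k - L j k) < eps.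
Proof.
move=> AM Afin.
(* The sets of tuples piercing a finite list form a filter base: concatenating two lists refines
   both conditions. *)
pose B (l : {n : nat & 'I_n -> I}) (S : 'I_c -> X) :=
  forall m, exists j, A (projT2 l m) (S j).
have BF : ProperFilter (filter_from classical_sets.setT B).
  apply: filter_from_proper.
    apply: filter_from_filter.
      by exists (existT (fun n => 'I_n -> I) 0%N (fun o : 'I_0 =>
        False_rect I (notF (ltn_ord o)))).
    move=> [n g] [n' g'] _ _.
    exists (existT (fun n => 'I_n -> I) (n + n')%N (fun m => match split m with
      inl a => g a | inr b => g' b end)) => // S BS.
    split=> m.
      by have := BS (lshift n' m); rewrite /= (unsplitK (inl m)).
    by have := BS (rshift n m); rewrite /= (unsplitK (inr m)).
  move=> [n g] _; have [S [Sc Sg]] := Afin n g.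
  exists (fun j => nth x0 S j) => m; have [x [xS xA]] := Sg m.
  have [k kS kx] := In_nth x0 xS.
  by exists (Ordinal (leq_trans kS Sc)); rewrite /= kx.
have [U [UU BU]] := ultraFilterLemma BF.
have UA i : exists j, U (fun S => A i (S j)).
  apply: ultra_exists; apply: BU.
  exists (existT (fun n => 'I_n -> I) 1%N (fun _ => i)) => // S /(_ ord0) [j ?]; by exists j.
(* If no member contains position [j] almost surely, [phi] may be unbounded there; the limit
   defaults to 0 and such a [j] is never selected. *)
have lim jk : exists l, (exists i, U (fun S => A i (S jk.1))) ->
    forall eps, 0 < eps -> U (fun S => Rabs (phi (S jk.1) jk.2 - l) < eps).
  case: jk => j k /=.
  have [[i Ui]|nU] := pselect (exists i, U (fun S => A i (S j))).
    have [|l ll] := @ultra_cvg _ U (fun S => phi (S j) k) M UU.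
      by apply: filterS Ui => S; apply: AM.
    by exists l.
  by exists 0 => /nU.
have [L LP] := choice lim.
exists (fun j k => L (j, k)) => i; have [j Uj] := UA i.
exists j => eps e0.
have Uk : U (fun S => forall k, Rabs (phi (S j) k - L (j, k)) < eps).
  by apply: filter_forall => k; apply: (LP (j, k)) => //; exists i.
by have [S [SA Sk]] := filter_ex (filterI Uj Uk); exists (S j).
Qed.

(** The last clause makes [N] the maximum of 1 and the sup norm; it keeps limits at infinity from
    vanishing. *)
Lemma finite_sup (n : nat) (x : 'I_n -> R) :
  exists N, [/\ 1 <= N, forall k, Rabs (x k) <= N
              & N = 1 \/ exists k, Rabs (x k) = N].
Proof.
suff H (s : seq 'I_n) : exists N, [/\ 1 <= N, forall k, k \in s -> Rabs (x k) <= N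
              & N = 1 \/ exists k, Rabs (x k) = N].
  by have [N [? NH ?]] := H (enum 'I_n); exists N; split=> // k; apply/NH/mem_enum.
elim: s => [|a s [N [N1 Ns Ne]]]; first by exists 1; split; [lra| |left].
have [aN|Na] := Rle_lt_dec (Rabs (x a)) N.
  by exists N; split=> // k; rewrite inE => /predU1P[->|/Ns].
exists (Rabs (x a)); split; [lra| |by right; exists a].
by move=> k; rewrite inE => /predU1P[->|/Ns]; lra.
Qed.

End Compactness.

(** * Points at infinity *)

Section Infinity.
Local Open Scope R_scope.

Lemma Rabs_div_pos x y : 0 < y -> Rabs (x / y) = Rabs x / y.
Proof. by move=> y0; rewrite Rabs_mult Rabs_inv (Rabs_right y); lra. Qed.

(** Homogeneous coordinates scaled into the unit cube. [None] indexes the homogenising coordinate,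
    whose limit is positive for a finite point and 0 for a direction. *)
Definition homog d (N : point d -> R) (x : point d) (k : option 'I_d) : R :=
  if k is Some i then x i / N x else / N x.

Definition recedes d (u : point d) (C : rset d) : Prop :=
  forall y t, C y -> 0 <= t -> C (fun i => y i + t * u i).

Variables (d : nat) (N : point d -> R).
Hypothesis NP : forall x, [/\ 1 <= N x, forall k, Rabs (x k) <= N x
                            & N x = 1 \/ exists k, Rabs (x k) = N x].

Lemma homog_le1 x k : Rabs (homog N x k) <= 1.
Proof.
have [N1 xN _] := NP x.
have iN : 0 < / N x by apply: Rinv_0_lt_compat; lra.
have e : N x * / N x = 1 by apply: Rinv_r; lra.
case: k => [i|] /=.
  rewrite Rabs_div_pos /Rdiv; last lra.
  by have := xN i; nra.
rewrite Rabs_right; last lra.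
by nra.
Qed.

Definition homog_limit (C : rset d) (w : option 'I_d -> R) : Prop :=
  forall eps, 0 < eps -> exists x, C x /\ forall k, Rabs (homog N x k - w k) < eps.

Variables (C : rset d) (w : option 'I_d -> R).
Hypotheses (Ccl : closed_set C) (Cw : homog_limit C w).

Lemma homog_limit_ge0 : 0 <= w None.
Proof.
case: (Rle_lt_dec 0 (w None)) => // w0.
have w0' : 0 < - w None by lra.
have [x [_ /(_ None) /= xw]] := Cw w0'.
have [N1 _ _] := NP x.
have iN : 0 < / N x by apply: Rinv_0_lt_compat; lra.
by move: xw; rewrite Rabs_right; lra.
Qed.

Lemma homog_limit_finite : 0 < w None -> C (fun i => w (Some i) / w None).
Proof.
set s := w None => s0; apply: Ccl => eps e0.
have [V [V1 wV _]] := finite_sup (fun i => w (Some i)).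
(* The first bound keeps [a = / N x] above [s / 2]; the second controls the error of the quotient,
   which is below [del * (s + V) / (a * s)]. *)
pose del := Rmin (s / 2) (eps * (s * s) / (2 * (s + V))).
have h1 : 0 < eps * (s * s) / (2 * (s + V)).
  by apply: Rdiv_lt_0_compat; [apply: Rmult_lt_0_compat => //; nra|lra].
have del0 : 0 < del by apply: Rmin_glb_lt; lra.
have [x [Cx xw]] := Cw del0.
exists x; split=> // i.
have := xw None; have := xw (Some i); rewrite /= -/s.
have [N1 _ _] := NP x.
set a := / N x; set v := w (Some i).
have a0 : 0 < a by apply: Rinv_0_lt_compat; lra.
have -> : x i / N x = x i * a by [].
move=> hi hN.
have d1 : del <= s / 2 by apply: Rmin_l.
have d2 : del * (2 * (s + V)) <= eps * (s * s).
  have := Rmin_r (s / 2) (eps * (s * s) / (2 * (s + V))); rewrite -/del => h.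
  have -> : eps * (s * s) = eps * (s * s) / (2 * (s + V)) * (2 * (s + V)).
    by field; lra.
  by apply: Rmult_le_compat_r => //; lra.
have as2 : s / 2 <= a by have := Rabs_def2 _ _ hN; lra.
have -> : v / s - x i = - ((x i * a - v) * s + v * (s - a)) / (a * s).
  by field; lra.
have as0 : 0 < a * s by nra.
rewrite Rabs_div_pos // Rabs_Ropp.
apply: (Rmult_lt_reg_r (a * s)) => //.
have -> : Rabs ((x i * a - v) * s + v * (s - a)) / (a * s) * (a * s)
    = Rabs ((x i * a - v) * s + v * (s - a)) by field; lra.
have := Rabs_triang ((x i * a - v) * s) (v * (s - a)).
rewrite !Rabs_mult (Rabs_right s); last lra.
have := wV i; rewrite -/v (Rabs_minus_sym s a) => vV.
have v0 := Rabs_pos v; have p2 := Rabs_pos (a - s).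
have q1 : Rabs (x i * a - v) * s < del * s by apply: Rmult_lt_compat_r.
have q2 : Rabs v * Rabs (a - s) <= V * del by apply: Rmult_le_compat; lra.
have q3 : eps * (s * s) <= eps * (2 * (a * s)) by apply: Rmult_le_compat_l; nra.
by lra.
Qed.

(** For [x] in [C] near the limit, the point of the segment from [y] to [x] with weight [t / N x] on
    [x] is close to [y + t w]. *)
Lemma homog_limit_recedes : convex_set C -> w None = 0 ->
  recedes (fun i => w (Some i)) C.
Proof.
move=> Ccv w0 y t Cy t0; apply: Ccl => eps e0.
have [V [V1 yV _]] := finite_sup y.
pose del := Rmin (/ (t + 1)) (eps / ((t + 1) * (1 + V))).
have ti : 0 < / (t + 1) by apply: Rinv_0_lt_compat; lra.
have h1 : 0 < eps / ((t + 1) * (1 + V)) by apply: Rdiv_lt_0_compat => //; nra.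
have del0 : 0 < del by apply: Rmin_glb_lt.
have [x [Cx xw]] := Cw del0.
have [N1 _ _] := NP x.
have := xw None; rewrite /= w0 Rminus_0_r.
have a0 : 0 < / N x by apply: Rinv_0_lt_compat; lra.
rewrite Rabs_right; last lra.
set a := / N x in a0 * => ad.
have d1 : del * (t + 1) <= 1.
  rewrite -[X in _ <= X](Rinv_l (t + 1)); last lra.
  by apply: Rmult_le_compat_r; [lra|apply: Rmin_l].
have d2 : del * ((t + 1) * (1 + V)) <= eps.
  have -> : eps = eps / ((t + 1) * (1 + V)) * ((t + 1) * (1 + V)).
    by field; lra.
  by apply: Rmult_le_compat_r; [nra|apply: Rmin_r].
exists (fun i => t * a * x i + (1 - t * a) * y i); split.
  by apply: Ccv => //; nra.
move=> i.
have -> : y i + t * w (Some i) - (t * a * x i + (1 - t * a) * y i)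
   = t * (- (x i / N x - w (Some i)) + a * y i).
  by rewrite /a; field; lra.
have := xw (Some i); rewrite /=; set z := x i / N x - _ => zd.
have := Rabs_triang (- z) (a * y i).
rewrite !Rabs_mult Rabs_Ropp (Rabs_right t) ?(Rabs_right a); try lra.
move=> tr; have := yV i => yiV; have := Rabs_pos (y i) => yi0.
have q1 : a * Rabs (y i) <= del * V by apply: Rmult_le_compat; lra.
have q2 : Rabs (- z + a * y i) <= del * (1 + V) by lra.
have q3 : t * Rabs (- z + a * y i) <= t * (del * (1 + V)).
  by apply: Rmult_le_compat_l.
have q4 : 0 < del * (1 + V) by nra.
by nra.
Qed.

Lemma homog_limit_neq0 : w None = 0 -> exists i, w (Some i) <> 0.
Proof.
(* Within 1/2 of the limit, [/ N x] is not 1, so some coordinate of [x / N x] has absolute value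
   1. *)
move=> w0; have h2 : 0 < / 2 by lra.
have [x [_ xw]] := Cw h2.
have [N1 xN [Ne|[k kN]]] := NP x.
  have := xw None; rewrite /= w0 Ne Rabs_right; lra.
exists k => wk; have := xw (Some k); rewrite /= wk Rminus_0_r.
rewrite Rabs_div_pos ?kN; last lra.
have -> : N x / N x = 1 by field; lra.
by lra.
Qed.

End Infinity.

(** * Projection along a direction *)

Section Projection.
Local Open Scope R_scope.

(** For nonzero [u k], the projection along [u] onto the hyperplane where coordinate [k]
    vanishes. *)
Definition proj_along d (u : point d.+1) (k : 'I_d.+1) (x : point d.+1) : point d :=
  fun j => x (lift k j) - u (lift k j) / u k * x k.

Definition section_at d (k : 'I_d.+1) (y : point d) : point d.+1 :=
  fun i => if unlift k i is Some j then y j else 0.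

Definition in_box d (M : R) (x : point d) : Prop := forall i, Rabs (x i) <= M.

Lemma in_box_convex d M : convex_set (@in_box d M).
Proof.
move=> x y xM yM t t01 i; have := Rabs_triang (t * x i) ((1 - t) * y i).
rewrite !Rabs_mult (Rabs_right t) ?(Rabs_right (1 - t)); try lra.
by have := xM i; have := yM i; nra.
Qed.

Lemma in_box_closed d M : closed_set (@in_box d M).
Proof.
move=> x xM i; apply: Rle_plus_epsilon => e e0; have [y [yM xy]] := xM e e0.
have := yM i; have := xy i; have := Rabs_triang (x i - y i) (y i).
have -> : x i - y i + y i = x i by lra.
by lra.
Qed.

(** The box comes before the projection because the image of an unbounded closed set may fail to be
    closed. *)
Definition proj_box d (u : point d.+1) k M (C : rset d.+1) : rset d :=
  fun y => exists x, [/\ C x, in_box M x & forall j, proj_along u k x j = y j].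

Variables (d : nat) (u : point d.+1) (k : 'I_d.+1) (M : R).

Lemma section_proj_along x i : u k <> 0 ->
  x i = section_at k (proj_along u k x) i + x k / u k * u i.
Proof.
move=> uk; rewrite /section_at /proj_along.
by case: unliftP => [j ->|->]; field.
Qed.

Lemma proj_along_bounded :
  exists M', forall x, in_box M x -> in_box M' (proj_along u k x).
Proof.
have [A [A1 uA _]] := finite_sup (fun i => u i / u k).
exists (M + A * M) => x xM j; rewrite /proj_along.
have := Rabs_triang (x (lift k j)) (- (u (lift k j) / u k * x k)).
rewrite Rabs_Ropp Rabs_mult.
have := xM (lift k j); have := xM k; have := uA (lift k j).
have := Rabs_pos (x k); have := Rabs_pos (u (lift k j) / u k).
rewrite /Rminus => *.
suff: Rabs (u (lift k j) / u k) * Rabs (x k) <= A * M by lra.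
by apply: Rmult_le_compat.
Qed.

Lemma proj_box_convex C : convex_set C -> convex_set (proj_box u k M C).
Proof.
move=> Ccv y y' [x [Cx xM xy]] [x' [Cx' xM' xy']] t t01.
exists (fun i => t * x i + (1 - t) * x' i); split; first exact: Ccv.
  exact: in_box_convex.
by move=> j; rewrite -xy -xy' /proj_along; lra.
Qed.

Lemma proj_box_closed C : closed_set C -> closed_set (proj_box u k M C).
Proof.
move=> Ccl y yC.
(* Compactness with one-element tuples gives a single limit, for all [e], of points that project to
   within [e] of [y]. *)
pose A (e : {e : R | 0 < e}) x := [/\ C x, in_box M x
  & forall j, Rabs (y j - proj_along u k x j) < sval e].
have [||L LP] := @compact_piercing {e : R | 0 < e} (point d.+1) 'I_d.+1
  (fun=> 0) id M 1 A.
- by move=> e x i [].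
- move=> n g; have [N [N1 gN _]] := finite_sup (fun m => / sval (g m)).
  have [|y' [[x [Cx xM xy]] yy]] := yC (/ N); first by apply: Rinv_0_lt_compat; lra.
  exists [:: x]; split=> // m; exists x; split; first by left.
  split=> // j; rewrite xy; apply: Rlt_le_trans (yy j) _.
  have := gN m; case: (g m) => e /= e0.
  have ie : 0 < / e by apply: Rinv_0_lt_compat.
  rewrite Rabs_right; last lra.
  by move=> h; rewrite -(Rinv_inv e); apply: Rinv_le_contravar.
have {}LP e : 0 < e -> exists x, [/\ C x, in_box M x,
    forall j, Rabs (y j - proj_along u k x j) < e &
    forall i, Rabs (x i - L ord0 i) < e].
  move=> e0; have [j] := LP (exist _ e e0); rewrite (ord1 j) => /(_ e e0).
  by move=> [x [[? ? ?] ?]]; exists x.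
exists (L ord0); split.
- apply: Ccl => e e0; have [x [Cx _ _ xL]] := LP e e0.
  by exists x; split=> // i; rewrite Rabs_minus_sym.
- apply: in_box_closed => e e0; have [x [_ xM _ xL]] := LP e e0.
  by exists x; split=> // i; rewrite Rabs_minus_sym.
move=> j; apply: cond_eq => e e0.
set a := u (lift k j) / u k.
have A0 := Rabs_pos a.
pose del := e / (2 + Rabs a).
have del0 : 0 < del by apply: Rdiv_lt_0_compat; lra.
have de : del * (2 + Rabs a) = e by rewrite /del; field; lra.
have [x [_ _ xy xL]] := LP del del0.
have := xy j; rewrite /proj_along -/a => h1.
have h2 := xL (lift k j); have h3 := xL k.
have -> : L ord0 (lift k j) - a * L ord0 k - y j =
  - (y j - (x (lift k j) - a * x k)) +
  (- (x (lift k j) - L ord0 (lift k j)) + a * (x k - L ord0 k)) by lra.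
set p := y j - _ in h1 *; set r := x (lift k j) - _ in h2 *.
set t := x k - _ in h3 *.
have := Rabs_triang (- p) (- r + a * t); have := Rabs_triang (- r) (a * t).
rewrite !Rabs_Ropp Rabs_mult => g1 g2.
have : Rabs a * Rabs t <= Rabs a * del by apply: Rmult_le_compat_l; lra.
by lra.
Qed.

End Projection.

(** * The upper bound *)

(** [pq_property] counts distinct indices, so repetitions must go before a finite selection can be
    treated as a family. *)
Lemma dedup_family (I : Type) n (g : 'I_n -> I) :
  exists m (h : 'I_m -> I), injective h /\ forall j, exists k, h k = g j.
Proof.
pose s := undup [seq (g j : {classic I}) | j <- enum 'I_n].
exists (size s), (tnth (in_tuple s)); split.
  by apply: (elimT (tuple_uniqP (in_tuple s))); apply: undup_uniq.
move=> j; have js : (g j : {classic I}) \in s.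
  by rewrite mem_undup; apply/map_f/mem_enum.
by have [k ->] := @tnthP _ _ (in_tuple s) _ js; exists k.
Qed.

(** The selection may have fewer than [p] members, so [p] distinct members of [F] are adjoined
    first. *)
Lemma xi_bound_finite_subfamily p q d c (I : Type) (F : I -> rset d) n (g : 'I_n -> I) :
  xi_bound p q d c -> (forall i, closed_convex (F i)) -> pq_property p q F ->
  piercing_le (fun m => F (g m)) c.
Proof.
move=> xi Fcc [[f finj] Fpq].
have [m [h [hinj hg]]] := dedup_family (fun a : 'I_(n + p) => match split a with
  inl a => g a | inr b => f b end).
have [S [Sc SF]] : piercing_le (fun a => F (h a)) c.
  apply: xi => [a|]; first exact: Fcc.
  split; last first.
    by move=> f' f'inj; apply: (Fpq (h \o f')); apply: inj_comp.
  have hf (b : 'I_p) : exists k, h k = f b.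
    by have := hg (rshift n b); rewrite (unsplitK (inr b)).
  have [r rP] := choice hf; exists r => a b rab.
  by apply: finj; rewrite -!rP rab.
exists S; split=> // a.
have := hg (lshift p a); rewrite (unsplitK (inl a)) => -[k <-].
exact: SF.
Qed.

(** Even [r] copies of the whole space need a point. *)
Lemma xi_bound_gt0 r q d c : 0 < q -> q <= r -> xi_bound r q d c -> 0 < c.
Proof.
move=> q0 qr xi.
have [||S [Sc SF]] := xi r (fun _ _ => True).
- by move=> _; split; [exists (fun=> 0%R)|].
- split; first by exists id.
  move=> f _; exists (widen_ord qr); split; last by exists (fun=> 0%R).
  by move=> a b /(congr1 val) /= ab; apply: val_inj.
have [x [xS _]] := SF (Ordinal (leq_trans q0 qr)).
by apply: leq_trans Sc; case: (S) xS.
Qed.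

(** The projected box parts of all members are pierced by [c] points; only the lifting uses
    recession along [u]. *)
Lemma pierce_receding d r c M (I : Type) (F : I -> rset d.+1)
    (u : point d.+1) k :
  (forall i, closed_convex (F i)) -> (forall i, exists x, F i x /\ in_box M x) ->
  pq_property r d.+1 (fun i x => F i x /\ in_box M x) ->
  xi_bound r d.+1 d c -> u k <> 0%R ->
  exists S : seq (point d.+1), size S <= c /\
    forall i, recedes u (F i) -> exists x, List.In x S /\ F i x.
Proof.
move=> Fcc FM [ex Fpq] xi uk.
pose K i := proj_box u k M (F i).
have Kcl i : closed_set (K i) by apply: proj_box_closed; have [_ []] := Fcc i.
have Kcc i : closed_convex (K i).
  have [_ [Fcv Fcl]] := Fcc i; split; last by split=> //; apply: proj_box_convex.
  by have [x [Fx xM]] := FM i; exists (proj_along u k x), x.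
have Kpq : pq_property r d.+1 K.
  split=> // f finj; have [g [ginj [x xF]]] := Fpq f finj.
  exists g; split=> //; exists (proj_along u k x) => j.
  by have [? ?] := xF j; exists x.
have [M' M'P] := proj_along_bounded u k M.
have [||L LP] := @compact_piercing I (point d) 'I_d (fun=> 0%R) id M' c K.
- by move=> i y j [x [_ xM <-]]; apply: M'P.
- by move=> n g; apply: (xi_bound_finite_subfamily g xi).
(* [T] bounds [x k / u k] over the box, so the lifted point is [x] plus a nonnegative multiple of
   [u] for any [x] of the box above [L j]. *)
pose T := (M / Rabs (u k))%R.
exists [seq (fun i => section_at k (L j) i + T * u i)%R | j <- enum 'I_c].
split; first by rewrite size_map size_enum_ord.
move=> i Fu; have [j jP] := LP i.
have [x [Fx xM xL]] : K i (L j).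
  apply: Kcl => e e0; have [y [Ky yL]] := jP e e0; exists y; split=> // l.
  by rewrite Rabs_minus_sym.
exists (fun i => section_at k (L j) i + T * u i)%R; split.
  by apply: (In_map (fun j i => _)); rewrite mem_enum.
have uk0 : (0 < Rabs (u k))%R by apply: Rabs_pos_lt.
have tT : (x k / u k <= T)%R.
  apply: Rle_trans (Rle_abs _) _; rewrite Rabs_mult Rabs_inv.
  apply: Rmult_le_compat_r (xM k).
  by apply/Rlt_le/Rinv_0_lt_compat.
have tT' : (0 <= T - x k / u k)%R by lra.
rewrite (_ : (fun i => _) = fun l => x l + (T - x k / u k) * u l)%R; first exact: Fu.
apply/funext => l.
have <- : proj_along u k x = L j by apply/funext.
by rewrite [in RHS](section_proj_along x l uk); lra.
Qed.

(** A finite limit is a common point of its members, and [xi_bound_gt0] leaves room for it; any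
    other limit is a common direction of recession. *)
Lemma pierce_limit_point d r c M N (I : Type) (F : I -> rset d.+1)
    (w : option 'I_d.+1 -> R) :
  (forall x, [/\ 1 <= N x, forall k, Rabs (x k) <= N x
     & N x = 1 \/ exists k, Rabs (x k) = N x])%R ->
  d < r ->
  (forall i, closed_convex (F i)) -> (forall i, exists x, F i x /\ in_box M x) ->
  pq_property r d.+1 (fun i x => F i x /\ in_box M x) ->
  xi_bound r d.+1 d c ->
  exists S : seq (point d.+1), size S <= c /\
    forall i, homog_limit N (F i) w -> exists x, List.In x S /\ F i x.
Proof.
move=> NP dr Fcc FM Fpq xi.
have [[i0 wi0]|nw] := pselect (exists i, homog_limit N (F i) w); last first.
  by exists [::]; split=> // i wi; case: nw; exists i.
have [w0|w0] := Rle_lt_or_eq_dec _ _ (homog_limit_ge0 NP wi0).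
  exists [:: (fun i => w (Some i) / w None)%R]; split.
    exact: xi_bound_gt0 (ltn0Sn d) dr xi.
  move=> i wi; exists (fun i => w (Some i) / w None)%R; split; first by left.
  by have [_ [_ Fcl]] := Fcc i; apply: (homog_limit_finite NP Fcl wi).
have [k wk] := homog_limit_neq0 NP wi0 (esym w0).
have [S [Sc SF]] := pierce_receding (u := fun i => w (Some i)) Fcc FM Fpq xi wk.
exists S; split=> // i wi; apply: SF.
have [_ [Fcv Fcl]] := Fcc i.
exact: (homog_limit_recedes NP Fcl wi Fcv).
Qed.

Lemma piercing_le_unbounded d r c1 c2 M (I : Type) (F : I -> rset d.+1) :
  d < r ->
  (forall i, closed_convex (F i)) -> (forall i, exists x, F i x /\ in_box M x) ->
  pq_property r d.+1 (fun i x => F i x /\ in_box M x) ->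
  xi_bound r d.+1 d c1 ->
  (forall n (g : 'I_n -> I), piercing_le (fun m => F (g m)) c2) ->
  piercing_le F (c1 * c2).
Proof.
move=> dr Fcc FM Fpq xi1 Ffin.
have [N NP] := choice (@finite_sup d.+1).
have [|L LP] := compact_piercing (fun=> 0%R) (phi := homog N) (M := 1%R) _ Ffin.
  by move=> i x k _; apply: homog_le1.
have SL j := pierce_limit_point (L j) NP dr Fcc FM Fpq xi1.
have [S SP] := choice SL.
exists (flatten [seq S j | j <- enum 'I_c2]); split.
  rewrite -[X in _ <= _ * X](size_enum_ord c2); apply: size_flatten_map => j.
  by have [] := SP j.
move=> i; have [j ij] := LP i; have [_ /(_ i ij) [x [xS Fx]]] := SP j.
by exists x; split=> //; apply: In_flatten_map xS; rewrite mem_enum.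
Qed.

(** Otherwise [r] distinct members miss the box of [M0], each new one being chosen to miss a larger
    box that meets all earlier ones. But [s > 0] of them must meet inside the box of [M0]. *)
Lemma meet_common_box d r s M0 (I : Type) (F : I -> rset d) :
  0 < s -> (forall i, exists x, F i x) ->
  pq_property r s (fun i x => F i x /\ in_box M0 x) ->
  exists M, (M0 <= M)%R /\ forall i, exists x, F i x /\ in_box M x.
Proof.
move=> s0 Fne [_ Fpq]; apply: contrapT => nM.
have far M : (M0 <= M)%R -> exists i, forall x, F i x -> ~ in_box M x.
  move=> MM; apply: contrapT => ni; apply: nM; exists M; split=> // i.
  apply: contrapT => nx; apply: ni; exists i => x Fx xM; apply: nx; by exists x.
suff [f [finj fM]] : exists f : 'I_r -> I, injective f /\
    forall j x, F (f j) x -> ~ in_box M0 x.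
  have [g [_ [x xF]]] := Fpq f finj; have [Fx xM] := xF (Ordinal s0).
  exact: fM Fx xM.
elim: r {Fpq} => [|n [f [finj fM]]]; first by exists (fun o : 'I_0 =>
  False_rect I (notF (ltn_ord o))); split; case.
have [x xF] := choice (fun j => Fne (f j)).
have [y yP] := choice (fun j => finite_sup (x j)).
have [B [_ By _]] := finite_sup y.
have MM := Rmax_l M0 B.
have [i iP] := far _ MM.
have fi j : f j <> i.
  move=> e; apply: (iP (x j)); first by rewrite -e.
  move=> k; have [_ yk _] := yP j; have := yk k; have := By j.
  by have := Rle_abs (y j); have := Rmax_r M0 B; lra.
exists (fun o => if unlift ord0 o is Some j then f j else i); split.
  move=> a b; case: unliftP => [a' ->|->]; case: unliftP => [b' ->|->] //.
  - by move/finj => ->.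
  - by move/fi.
  - by move/esym/fi.
move=> o z; case: unliftP => [j _|_] Fz zM; first exact: fM Fz zM.
by apply: iP Fz _ => k; have := zM k; lra.
Qed.

(** Of [r] others and the [k] bounded members, [r + 1] share a point. They cannot all be others, so
    the point is in the box; at most [k] are bounded, so at least [s] are others. *)
Lemma pq_property_other_members d r k s M (I : Type) (F : I -> rset d) (b : 'I_k -> I) :
  0 < k -> s + k <= r.+1 -> injective b -> (forall j x, F (b j) x -> in_box M x) ->
  pq_property (r + k) r.+1 F ->
  pq_property r s (fun (i : {i | forall j, b j <> i}) x => F (sval i) x /\ in_box M x).
Proof.
move=> k0 skr binj bM [[f finj] Fpq]; split.
  (* At most [k] of the [r + k] distinct members given by [f] are among the [b j], which leaves [r]
     others. *)
  pose D := [set a | `[< forall j, b j <> f a >]].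
  have hP a : exists j, a \in ~: D -> b j = f a.
    rewrite !inE; case: asboolP => [_|/existsNP[j /contrapT ?]]; last by exists j.
    by exists (Ordinal k0).
  have [h {}hP] := choice hP.
  have hD : #|~: D| <= k.
    rewrite -(card_in_imset (f := h)); first by rewrite -[X in _ <= X]card_ord max_card.
    by move=> a a' /hP ha /hP ha' e; apply: finj; rewrite -ha -ha' e.
  have [|g ginj gD] := @injection_into _ D r.
    by have := cardsC D; rewrite card_ord; lia.
  have gb j i : b i <> f (g j) by have := gD j; rewrite inE => /asboolP.
  exists (fun j => exist _ (f (g j)) (gb j)) => a a' /(congr1 sval) /=.
  by move/finj/ginj.
move=> f' f'inj.
pose e a := match split a with inl x => sval (f' x) | inr y => b y end.
have einj : injective e.
  move=> a a' aa; rewrite -(splitK a) -(splitK a'); move: aa; rewrite /e.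
  case: (split a) => x; case: (split a') => x' /=.
  - by move=> /(eq_sig_hprop (fun i => @Prop_irrelevance _)) /f'inj ->.
  - by move=> xx; case: (svalP (f' x) x').
  - by move=> xx; case: (svalP (f' x') x).
  - by move/binj ->.
have [g [ginj [x xF]]] := Fpq e einj.
pose A := [set a : 'I_r | lshift k a \in codom g].
pose B := [set y : 'I_k | rshift r y \in codom g].
have AB : r.+1 <= #|A| + #|B|.
  rewrite -[X in X <= _]card_ord -cardsT -(card_imset _ ginj).
  apply: leq_trans (leq_add (leq_imset_card (lshift k) A)
    (leq_imset_card (@rshift r k) B)).
  apply: leq_trans (leq_card_setU _ _); apply/subset_leq_card/subsetP => a.
  move=> /imsetP[j _ ->]; rewrite inE; case: (split_ordP (g j)) => y gy.
    by rewrite gy imset_f // inE -gy codom_f.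
  by apply/orP; right; rewrite gy imset_f // inE -gy codom_f.
have Ar : #|A| <= r by rewrite -[X in _ <= X]card_ord max_card.
have Bk : #|B| <= k by rewrite -[X in _ <= X]card_ord max_card.
have /card_gt0P [y] : 0 < #|B| by lia.
rewrite inE => /codomP[j yj].
have xM : in_box M x.
  apply: (bM y); have := xF j.
  by rewrite /e -yj (unsplitK (inr y)).
have [|g' g'inj g'A] := @injection_into _ A s; first by lia.
exists g'; split=> //; exists x => a; split=> //.
have := g'A a; rewrite inE => /codomP[i ai].
by have := xF i; rewrite /e -ai (unsplitK (inl _)).
Qed.

(** Here [r] is [q - 1] and [k] is [p - q + 1], in dimension [d.+1]; then [d.+1 + k <= r.+1] is the
    inequality assumed in (i). *)
Lemma piercing_upper_bound d r k c1 c2 (I : Type) (F : I -> rset d.+1) (b : 'I_k -> I) :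
  0 < k -> d.+1 + k <= r.+1 -> (forall i, closed_convex (F i)) ->
  injective b -> (forall j, bounded_set (F (b j))) ->
  pq_property (r + k) r.+1 F ->
  xi_bound r d.+1 d c1 -> xi_bound (r + k) r.+1 d.+1 c2 ->
  piercing_le F (c1 * c2 + k).
Proof.
move=> k0 dkr Fcc binj bb Fpq xi1 xi2.
have [Mb MbP] := choice bb.
have [M0 [_ M0P _]] := finite_sup Mb.
have bM j x : F (b j) x -> in_box M0 x.
  by move=> /MbP h i; have := h i; have := M0P j; have := Rle_abs (Mb j); lra.
have [ex Gpq] := pq_property_other_members k0 dkr binj bM Fpq.
have [//||M [M0M GM]] := @meet_common_box _ r d.+1 M0 _
    (fun i : {i | forall j, b j <> i} => F (sval i)) _ _ (conj ex Gpq).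
  by move=> [i ni] /=; have [] := Fcc i.
have [||||S [Sc SG]] := @piercing_le_unbounded d r c1 c2 M _
    (fun i : {i | forall j, b j <> i} => F (sval i)) _ _ GM _ xi1.
- by lia.
- by move=> i; apply: Fcc.
- split=> // f finj; have [g [ginj [x xP]]] := Gpq f finj.
  exists g; split=> //; exists x => j; have [Fx xM] := xP j.
  by split=> // i; have := xM i; lra.
- by move=> n g; apply: (xi_bound_finite_subfamily (fun m => sval (g m)) xi2).
have [y yP] := choice (fun j => (Fcc (b j)).1).
exists (S ++ [seq y j | j <- enum 'I_k]); split.
  by rewrite size_cat size_map size_enum_ord leq_add2r.
move=> i; have [[j <-]|nj] := pselect (exists j, b j = i).
  exists (y j); split=> //; apply: List.in_or_app; right.
  by apply: In_map; rewrite mem_enum.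
have ni j : b j <> i by move=> e; apply: nj; exists j.
have [x [xS Fx]] := SG (exist _ i ni).
by exists x; split=> //; apply: List.in_or_app; left.
Qed.

(** * The counterexample *)

Section Polynomials.
Local Open Scope R_scope.

Definition peval (s : seq R) (m : R) : R := foldr (fun a acc => a + m * acc) 0 s.

Lemma peval_affine (T : Type) (s : seq T) (x y : T -> R) t m :
  peval [seq t * x j + (1 - t) * y j | j <- s] m =
  t * peval [seq x j | j <- s] m + (1 - t) * peval [seq y j | j <- s] m.
Proof. by elim: s => /= [|a s ->]; lra. Qed.

Lemma peval_lipschitz (T : Type) (s : seq T) m : exists2 c, 0 <= c &
  forall (x y : T -> R) e, (forall j, Rabs (x j - y j) <= e) ->
    Rabs (peval [seq x j | j <- s] m - peval [seq y j | j <- s] m) <= c * e.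
Proof.
elim: s => [|a s [c c0 cP]] /=.
  by exists 0; [lra|move=> *; rewrite Rminus_0_r Rabs_R0; lra].
have m0 := Rabs_pos m.
exists (1 + Rabs m * c); first by nra.
move=> x y e xy; have := cP x y e xy; have := xy a.
set p := peval _ m; set r := peval _ m => xa pr.
have -> : x a + m * p - (y a + m * r) = (x a - y a) + m * (p - r) by lra.
have := Rabs_triang (x a - y a) (m * (p - r)); rewrite Rabs_mult.
by have := Rmult_le_compat_l _ _ _ m0 pr; lra.
Qed.

(** Induction in Horner form: if the tail is at least [e] in absolute value, so is the whole once
    also [m >= 1 + Rabs a / e]. *)
Lemma peval_away (s : seq R) : (forall m, peval s m = 0) \/
  exists2 e, 0 < e & exists N, forall m, N <= m -> e <= Rabs (peval s m).
Proof.
elim: s => [|a s [z|[e e0 [N NP]]]]; first by left.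
  have [->|a0] := Req_dec a 0; first by left=> m /=; rewrite -/(peval s m) z; lra.
  right; exists (Rabs a); first exact: Rabs_pos_lt.
  by exists 0 => m _ /=; rewrite -/(peval s m) z Rmult_0_r Rplus_0_r; lra.
right; exists e => //; exists (Rmax N (1 + Rabs a / e)) => m mN.
have a0 := Rabs_pos a.
have ae : 0 <= Rabs a / e by apply: Rmult_le_pos => //; apply/Rlt_le/Rinv_0_lt_compat.
have m1 : N <= m by have := Rmax_l N (1 + Rabs a / e); lra.
have m2 : 1 + Rabs a / e <= m by have := Rmax_r N (1 + Rabs a / e); lra.
have m3 : e + Rabs a <= m * e.
  have -> : e + Rabs a = (1 + Rabs a / e) * e by field; lra.
  by apply: Rmult_le_compat_r => //; lra.
have := NP m m1; rewrite /= -/(peval s m); set r := peval s m => er.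
have := Rabs_triang_inv (m * r) (- a); rewrite Rabs_Ropp Rabs_mult (Rabs_right m); last lra.
have -> : m * r - - a = a + m * r by lra.
have : m * e <= m * Rabs r by apply: Rmult_le_compat_l; lra.
by lra.
Qed.

(* Multiplication by [1 - X / m], where [a] is the coefficient just before [s]. *)
Fixpoint mul_root (m a : R) (s : seq R) : seq R :=
  if s is a' :: s' then (a' - a / m) :: mul_root m a' s' else [:: - (a / m)].

Lemma size_mul_root m a s : size (mul_root m a s) = (size s).+1.
Proof. by elim: s a => //= a' s IH a; rewrite IH. Qed.

(** As a polynomial in [n], this is [(a + n P) (1 - n / m)] with its constant term [a] removed and
    the rest divided by [n]. *)
Lemma peval_mul_root m a s n : m <> 0 ->
  peval (mul_root m a s) n = peval s n - (a + n * peval s n) / m.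
Proof.
move=> m0; elim: s a => [|a' s IH] a /=; first by field.
by rewrite -/(peval _ _) IH -/(peval _ _); field.
Qed.

(** Since [m >= 1], each new coefficient is a difference of two numbers bounded by [B]. *)
Lemma mul_root_bound m a s B : 1 <= m -> 0 <= B -> Rabs a <= B ->
  (forall k, Rabs (nth 0 s k) <= B) ->
  forall k, Rabs (nth 0 (mul_root m a s) k) <= 2 * B.
Proof.
move=> m1 B0; have am x : Rabs x <= B -> Rabs (x / m) <= B.
  move=> xB; rewrite Rabs_div_pos; last lra.
  apply: (Rmult_le_reg_r m); first lra.
  have -> : Rabs x / m * m = Rabs x by field; lra.
  by nra.
elim: s a => [|a' s IH] a aB sB k /=.
  case: k => [|k] /=; first by rewrite Rabs_Ropp; have := am _ aB; lra.
  by rewrite nth_nil Rabs_R0; lra.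
case: k => [|k] /=.
  have := Rabs_triang a' (- (a / m)); rewrite Rabs_Ropp.
  by have := am _ aB; have := sB 0%N; rewrite /= /Rminus; lra.
apply: IH; first exact: (sB 0%N).
by move=> k'; apply: (sB k'.+1).
Qed.

(* [1 :: root_coefs l] lists the coefficients of the product of the [1 - X / (n + 1)]
   over [n] in [l]: normalising the constant term instead of the leading one keeps
   them bounded independently of [l]. *)
Definition root_coefs (l : seq nat) : seq R :=
  foldr (fun n s => mul_root (INR n.+1) 1 s) [::] l.

Lemma size_root_coefs l : size (root_coefs l) = size l.
Proof. by elim: l => //= n l IH; rewrite size_mul_root IH. Qed.

Lemma INR_S_ge1 n : 1 <= INR n.+1.
Proof. by rewrite S_INR; have := pos_INR n; lra. Qed.

Lemma root_coefs_bound l k : Rabs (nth 0 (root_coefs l) k) <= 2 ^ size l.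
Proof.
elim: l k => [|n l IH] k /=; first by rewrite nth_nil Rabs_R0; lra.
have p1 : 1 <= 2 ^ size l by apply: pow_R1_Rle; lra.
apply: mul_root_bound => //; [exact: INR_S_ge1|lra|by rewrite Rabs_R1].
Qed.

Lemma root_coefsP l n : n \in l -> 1 + INR n.+1 * peval (root_coefs l) (INR n.+1) = 0.
Proof.
elim: l => // n' l IH; rewrite inE.
rewrite -[root_coefs _]/(mul_root (INR n'.+1) 1 (root_coefs l)).
have n1 := INR_S_ge1 n; have n1' := INR_S_ge1 n'.
rewrite peval_mul_root; last lra.
move: n1 n1'; set m := INR _; set m' := INR _ => m1 m1'.
set P := peval _ _.
have -> : 1 + m * (P - (1 + m * P) / m') = (1 + m * P) * (1 - m / m') by field; lra.
case/predU1P => [e|/IH ->]; last by lra.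
by rewrite /m /m' e; field; rewrite -/m'; lra.
Qed.

End Polynomials.

Section Counterexample.
Local Open Scope R_scope.
Variable d : nat.

(** Affine in [z], and a polynomial in [m] with constant term 1. Coordinate [ord0] is left out to
    serve as the height. *)
Definition hyp_form (m : R) (z : point d.+1) : R :=
  1 + m * peval [seq z (lift ord0 j) | j <- enum 'I_d] m.

(* A neighbourhood, widening with the height [z_0], of a hyperplane dual to the
   moment curve. *)
Definition wedge (n : nat) : rset d.+1 := fun z =>
  Rabs (hyp_form (INR n.+1) z) <= z ord0 / INR n.+1.

(** The left summand indexes infinitely many copies of one box, whose size comes from
    [root_coefs_bound]. *)
Definition moment_family (i : nat + nat) : rset d.+1 :=
  match i with inl _ => in_box (2 ^ d) | inr n => wedge n end.

(** On the height axis the form is constantly 1, so a height of at least every [n + 1] suffices. *)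
Lemma wedge_top (l : seq nat) : exists z, forall n, n \in l -> wedge n z.
Proof.
exists (fun i => if i == ord0 then INR (\max_(n <- l) n).+1 else 0) => n nl.
rewrite /wedge /hyp_form.
have -> : peval [seq (if lift ord0 j == ord0 then INR (\max_(n <- l) n).+1 else 0)
   | j <- enum 'I_d] (INR n.+1) = 0.
  by elim: (enum 'I_d) => //= a s ->; lra.
have n1 := INR_S_ge1 n; rewrite eqxx Rmult_0_r Rplus_0_r Rabs_R1.
apply: (Rmult_le_reg_r (INR n.+1)); first lra.
rewrite Rmult_1_l /Rdiv Rmult_assoc Rinv_l ?Rmult_1_r; last lra.
by apply/le_INR/leP; rewrite ltnS (@leq_bigmax_seq _ l xpredT id).
Qed.

Lemma wedge_common_in_box (l : seq nat) : (size l <= d)%N ->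
  exists z, in_box (2 ^ d) z /\ forall n, n \in l -> wedge n z.
Proof.
(* Padding with repeated roots makes the coefficients fill exactly [d] coordinates; at height 0 the
   forms must then vanish, and they do. *)
move=> ld; pose l' := l ++ nseq (d - size l) 0%N.
have sl' : size l' = d by rewrite size_cat size_nseq subnKC.
pose s := root_coefs l'.
have ss : size s = d by rewrite size_root_coefs.
exists (fun i => if unlift ord0 i is Some j then nth 0 s j else 0); split.
  move=> i; case: unliftP => [j _|_]; last first.
    by rewrite Rabs_R0; apply: pow_le; lra.
  by rewrite -[X in _ <= 2 ^ X]sl'; apply: root_coefs_bound.
move=> n nl; rewrite /wedge /hyp_form unlift_none.
have -> : [seq (if unlift ord0 (lift ord0 j) is Some j then nth 0 s j else 0)
   | j <- enum 'I_d] = s.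
  rewrite -[RHS](mkseq_nth 0) /mkseq ss -val_enum_ord -map_comp.
  by apply: eq_map => j; rewrite liftK.
rewrite root_coefsP; last by rewrite mem_cat nl.
by rewrite Rabs_R0 /Rdiv Rmult_0_l; lra.
Qed.

Lemma wedge_closed_convex n : closed_convex (wedge n).
Proof.
split; first by have [z /(_ n) zP] := wedge_top [:: n]; exists z; apply: zP; rewrite inE.
have m1 := INR_S_ge1 n; have im : 0 < / INR n.+1 by apply: Rinv_0_lt_compat; lra.
split; rewrite /wedge /hyp_form; move: (INR n.+1) m1 im => m m1 im.
  move=> x y; set P := peval _ _; set Q := peval _ _ => xP yQ t t01.
  rewrite (peval_affine _ (fun j => x (lift ord0 j)) (fun j => y (lift ord0 j))) -/P -/Q.
  have -> : 1 + m * (t * P + (1 - t) * Q) = t * (1 + m * P) + (1 - t) * (1 + m * Q) by lra.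
  have := Rabs_triang (t * (1 + m * P)) ((1 - t) * (1 + m * Q)).
  rewrite !(Rabs_mult t) !(Rabs_mult (1 - t)) (Rabs_right t) ?(Rabs_right (1 - t)); try lra.
  by rewrite /Rdiv in xP yQ *; nra.
move=> x xU; have [c c0 cP] := peval_lipschitz (enum 'I_d) m.
apply: Rle_plus_epsilon => e e0.
(* [m * c + / m] is a Lipschitz constant for the difference of the two sides of the wedge
   inequality. *)
have den : 0 < m * c + / m by nra.
have [|y [yU xy]] := xU (e / (m * c + / m)); first exact: Rdiv_lt_0_compat.
move: yU xy; set del := e / _ => yU xy.
have de : del * (m * c + / m) = e by rewrite /del; field; split; nra.
have {cP} := cP (fun j => x (lift ord0 j)) (fun j => y (lift ord0 j)) del
  (fun j => Rlt_le _ _ (xy (lift ord0 j))).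
move: yU; set P := peval _ _; set Q := peval _ _ => yU PQ.
have := Rabs_triang (1 + m * P) (m * (Q - P)).
have -> : 1 + m * P + m * (Q - P) = 1 + m * Q by lra.
rewrite Rabs_mult (Rabs_right m); last lra.
have := Rmult_le_compat_l m _ _ _ PQ.
have := Rabs_def2 _ _ (xy ord0); rewrite /Rdiv in yU *; nra.
Qed.

(** At fixed [z] the form stays away from 0 for large [m], while [z ord0 / m] tends to 0. *)
Lemma wedge_finitely_often z : exists N, forall n, (N <= n)%N -> ~ wedge n z.
Proof.
have [z0|[e e0 [N NP]]] := peval_away (1 :: [seq z (lift ord0 j) | j <- enum 'I_d]).
  by have := z0 0; rewrite /=; lra.
have [N' N'P] := INR_unbounded (Rmax N (z ord0 / e)).
exists N' => n /leP /le_INR n1; rewrite /wedge => zn.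
have := Rmax_l N (z ord0 / e); have := Rmax_r N (z ord0 / e).
have := S_INR n; have := INR_S_ge1 n; move: zn; set m := INR n.+1 => zn m1 mn h1 h2.
have := NP m; rewrite /= -/(hyp_form m z) => /(_ ltac:(lra)) h3.
have h4 : z ord0 < m * e.
  have -> : z ord0 = z ord0 / e * e by field; lra.
  by apply: Rmult_lt_compat_r => //; lra.
have : e * m <= z ord0 / m * m by apply: Rmult_le_compat_r; lra.
have -> : z ord0 / m * m = z ord0 by field; lra.
by lra.
Qed.

Lemma moment_family_piercing_infinite : piercing_infinite moment_family.
Proof.
move=> S SP.
have [N NP] : exists N, forall n, (N <= n)%N -> forall x, List.In x S -> ~ wedge n x.
  elim: (S) => [|x s [N NP]]; first by exists 0%N.
  have [N' N'P] := wedge_finitely_often x.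
  exists (maxn N N') => n; rewrite geq_max => /andP[nN nN'] y /= [<-|ys].
    exact: N'P.
  exact: NP.
by have [x [xS /NP]] := SP (inr N); apply.
Qed.

Lemma moment_family_pq p q : (q <= p)%N -> (q <= p - q + d.+1)%N ->
  pq_property p q moment_family.
Proof.
move=> qp pqd; split; first by exists (fun i => inl (val i)) => a b [] /val_inj.
move=> f finj.
pose idx i := if f i is inr n then n else 0%N.
pose B := [set i | if f i is inr _ then true else false].
have BP i : i \in B -> f i = inr (idx i) by rewrite inE /idx; case: (f i).
have nBP i : i \notin B -> exists n, f i = inl n.
  by rewrite inE; case: (f i) => // n _; exists n.
have memidx (C : {set 'I_p}) i : i \in C -> idx i \in [seq idx i | i <- enum C].
  by move=> iC; apply: map_f; rewrite mem_enum.
have [qB|Bq] := leqP q #|B|.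
  have [g ginj gB] := injection_into qB; exists g; split=> //.
  have [z zP] := wedge_top [seq idx i | i <- enum B].
  by exists z => j; rewrite /= (BP _ (gB j)); apply/zP/memidx.
(* With fewer than [q] wedges, all boxes and up to [d] wedges are kept. *)
have [g ginj gB] := @injection_into _ B (minn d #|B|) (geq_minr _ _).
pose C := [set g j | j in setT].
have CB : C \subset B by apply/subsetP => i /imsetP[j _ ->].
have cC : #|C| = minn d #|B| by rewrite card_imset // cardsT card_ord.
(* If [#|B| <= d], all [p] members are kept; otherwise [#|B| < q] leaves at least [p - q + 1 + d],
   hence at least [q]. *)
have qD : (q <= #|~: B :|: C|)%N.
  rewrite cardsU (_ : ~: B :&: C = set0)%SET; last first.
    apply/setP => i; rewrite !inE; apply/andP => -[/negP iB iC]; apply: iB.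
    by have := subsetP CB i iC; rewrite inE.
  by rewrite cards0 cC; have := cardsC B; rewrite card_ord; lia.
have [h hinj hD] := injection_into qD; exists h; split=> //.
have [|z [zM zP]] := @wedge_common_in_box [seq idx i | i <- enum C].
  by rewrite size_map -cardE cC geq_minl.
exists z => j; have := hD j; rewrite !in_setU in_setC => /orP[/nBP[n ->] //|jC].
by rewrite (BP _ (subsetP CB _ jC)); apply/zP/memidx.
Qed.

End Counterexample.

Theorem theorem1p4 (p q d : nat) (hd : 0 < d) (hqd : d + 1 <= q) (hpq : q <= p) :
  (* (i) *)
  (p - q + (d + 1) <= q ->
   forall (I : Type) (F : I -> rset d),
     (forall i, closed_convex (F i)) ->
     (exists b : 'I_(p - q + 1) -> I, injective b /\ forall j, bounded_set (F (b j))) ->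
     pq_property p q F ->
     forall c1 c2 : nat, is_xi (q - 1) d (d - 1) c1 -> is_xi p q d c2 ->
       piercing_le F (c1 * c2 + (p - q + 1)))
  /\
  (* (ii) *)
  (q < p - q + (d + 1) ->
   exists (I : Type) (F : I -> rset d),
     (forall i, closed_convex (F i)) /\
     (exists b : nat -> I, injective b /\ forall j, bounded_set (F (b j))) /\
     pq_property p q F /\
     piercing_infinite F).
Proof.
case: d hd hqd => // d _ hqd; split.
  move=> hq I F Fcc [b [binj bb]] Fpq c1 c2 [xi1 _] [xi2 _].
  have ep : p = q - 1 + (p - q + 1) by lia.
  have eq : q = (q - 1).+1 by lia.
  rewrite [d.+1 - 1]subn1 /= in xi1.
  apply: (@piercing_upper_bound d (q - 1) _ c1 c2 I F b) => //.
  - by lia.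
  - by lia.
  - by rewrite -ep -eq.
  - by rewrite -ep -eq.
move=> hq; exists (nat + nat)%type, (@moment_family d); split; last split; last split.
- move=> [n|n]; last exact: wedge_closed_convex.
  split; last by split; [apply: in_box_convex|apply: in_box_closed].
  by exists (fun=> 0%R) => i; rewrite Rabs_R0; apply: pow_le; lra.
- exists inl; split; first by move=> a b [].
  by move=> j; exists (2 ^ d)%R.
- by apply: moment_family_pq; lia.
- exact: moment_family_piercing_infinite.
Qed.
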